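(* Let $p$ be a probability density on $\mathbb{R}^d$, let $T>0$, $N\ge1$, $h=T/N$, $t_k=kh$, and let $f:[0,T]\times\mathbb{R}^d\to\mathbb{R}^d$, $\hat s:[0,T]\times\mathbb{R}^d\to\mathbb{R}^d$ and $g:[0,T]\to\mathbb{R}$ be measurable with $g_{t_k}\neq0$ for $k=0,\dots,N-1$. Then the transition kernel on $\mathbb{R}^d$ of the MAD-Path algorithm (defined in the context) is reversible with respect to $p$. This holds for an arbitrary $\hat s$ (no relation between $\hat s_t$ and the score of any distribution is assumed) and for every step size $h$.
   Context: Write $\varphi(x;\mu,\Sigma)$ for the density at $x$ of $\mathcal N(\mu,\Sigma)$, $b_t(y):=-f_t(y)+g_t^2\hat s_t(y)$, and $$\overrightarrow{p}_k(x'\mid x)=\varphi\big(x';\,x+hf_{t_k}(x),\,g_{t_k}^2hI_d\big),\qquad \overleftarrow{p}_k(y\mid y')=\varphi\big(y;\,y'+hb_{t_k}(y'),\,g_{t_k}^2hI_d\big).$$ One MAD-Path iteration from the current state $x_0$ (with $p(x_0)>0$): (1) Forward pass: for $k=0,\dots,N-1$ draw $x_{k+1}\sim\overrightarrow{p}_k(\cdot\mid x_k)$, i.e. $x_{k+1}=x_k+hf_{t_k}(x_k)+g_{t_k}\sqrt h\,\varepsilon_k$ with $\varepsilon_k$ i.i.d. $\mathcal N(0,I_d)$. (2) Backward pass: set $y_N=x_N$, and for $k=N-1,\dots,0$ draw $y_k\sim\overleftarrow{p}_k(\cdot\mid y_{k+1})$, i.e. $y_k=y_{k+1}+hb_{t_k}(y_{k+1})+g_{t_k}\sqrt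 h\,\zeta_k$ with $\zeta_k$ i.i.d. $\mathcal N(0,I_d)$, independent of the forward noise. (3) The next state is $y_0$ with probability $$1\wedge\left[\frac{p(y_0)}{p(x_0)}\cdot\frac{\prod_{k=0}^{N-1}\overleftarrow{p}_k(x_k\mid x_{k+1})\ \prod_{k=0}^{N-1}\overrightarrow{p}_k(y_{k+1}\mid y_k)}{\prod_{k=0}^{N-1}\overrightarrow{p}_k(x_{k+1}\mid x_k)\ \prod_{k=0}^{N-1}\overleftarrow{p}_k(y_k\mid y_{k+1})}\right],$$ and is $x_0$ otherwise. (The acceptance rule on the $p$-null set $\{p(x_0)=0\}$ is irrelevant.) Reversibility with respect to $p$ of a kernel $K$ means $\int_A p(x)K(x,B)\,dx=\int_B p(x)K(x,A)\,dx$ for all Borel sets $A,B\subset\mathbb{R}^d$. *)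

(* Defs.v *)
From HB Require Import structures.
From mathcomp Require Import all_boot all_order all_algebra.
From mathcomp Require Import all_classical all_reals all_analysis.
From mathcomp Require Import ring.

Set Implicit Arguments.
Unset Strict Implicit.
Unset Printing Implicit Defensive.
Import Order.TTheory GRing.Theory Num.Theory.
Import numFieldNormedType.Exports.

Local Open Scope classical_set_scope.
Local Open Scope ring_scope.
Local Open Scope ereal_scope.

(* R^d is [d.-tuple R] with its canonical sigma-algebra, generated by the
   coordinates; as R is second countable, this is the Borel sigma-algebra. *)

Section cons_pair.
Context {R : realType} (n : nat).

(* The domain of [lebesgue_measure] is the alias [measurableTypeR R] of [R],
   which has the same measurable sets but another display. *)
Definition cons_pair (x : (measurableTypeR R * n.-tuple R)%type) :
  n.+1.-tuple R := [tuple of (x.1 : R) :: x.2].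

Lemma measurable_cons_pair : measurable_fun setT cons_pair.
Proof. exact: measurable_cons. Qed.

Let uncons (x : n.+1.-tuple R) : (measurableTypeR R * n.-tuple R)%type :=
  (thead x, [tuple of behead x]).

Let measurable_uncons : measurable_fun setT uncons.
Proof.
apply: measurable_fun_pair; last exact: measurable_behead.
by move=> _ Y mY; exact: (@measurable_tnth _ R _ ord0).
Qed.

Let cons_pairK : cancel cons_pair uncons.
Proof.
by move=> [x y]; rewrite /uncons /cons_pair/= theadE; congr pair; exact/val_inj.
Qed.

Variable m : {sigma_finite_measure set (n.-tuple R) -> \bar R}.

Definition cons_measure : set (n.+1.-tuple R) -> \bar R :=
  pushforward (@lebesgue_measure R \x m) cons_pair.

Let cons_measure0 : cons_measure set0 = 0.
Proof. by have := measurable_cons_pair => ?; exact: measure0. Qed.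

Let cons_measure_ge0 A : 0 <= cons_measure A.
Proof. by have := measurable_cons_pair => ?; exact: measure_ge0. Qed.

Let cons_measure_semi_sigma_additive : semi_sigma_additive cons_measure.
Proof.
by have := measurable_cons_pair => ?; exact: measure_semi_sigma_additive.
Qed.

HB.instance Definition _ := isMeasure.Build _ _ _ cons_measure
  cons_measure0 cons_measure_ge0 cons_measure_semi_sigma_additive.

Let cons_measure_sigma_finite : sigma_finite setT cons_measure.
Proof.
have /sigma_finiteP[F [FT ndF mF]] := sigma_finiteT (@lebesgue_measure R).
have /sigma_finiteP[G [GT ndG mG]] := sigma_finiteT m.
exists (fun k => uncons @^-1` (F k `*` G k)).
  rewrite -preimage_bigcup -(preimage_setT uncons); congr (_ @^-1` _).
  rewrite -setXTT FT GT; apply/seteqP; split => -[x y] /=.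
    move=> [[i _ Fix] [j _ Gjy]]; exists (maxn i j) => //; split.
      by move: x Fix; exact/subsetPset/ndF/leq_maxl.
    by move: y Gjy; exact/subsetPset/ndG/leq_maxr.
  by move=> [i _ [? ?]]; split; exists i.
move=> k; have [mFk Fkoo] := mF k; have [mGk Gkoo] := mG k; split.
  by rewrite -[X in measurable X]setTI; apply: measurable_uncons => //;
     exact: measurableX.
rewrite /cons_measure /pushforward (_ : _ @^-1` _ = F k `*` G k).
  by rewrite product_measure1E// lte_mul_pinfty// ge0_fin_numE.
by rewrite -comp_preimage (_ : uncons \o cons_pair = id)//; exact/funext.
Qed.

HB.instance Definition _ := Measure_isSigmaFinite.Build _ _ _ cons_measure
  cons_measure_sigma_finite.

End cons_pair.

(* Lebesgue measure on R^n as an iterated product, see [lebesgue_tuple_box]. *)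
Fixpoint lebesgue_tuple (R : realType) (n : nat) :
    {sigma_finite_measure set (n.-tuple R) -> \bar R} :=
  match n with
  | 0 => \d_ [tuple]
  | n'.+1 => cons_measure (lebesgue_tuple R n')
  end.

Lemma lebesgue_tuple_box (R : realType) n (A : 'I_n -> set R) : (forall i, measurable (A i)) ->
  lebesgue_tuple R n [set x | forall i, A i (tnth x i)] =
  \prod_(i < n) @lebesgue_measure R (A i).
Proof.
elim: n A => [|n IH] A mA.
  rewrite big_ord0 /= diracE mem_set//= => -[]//.
rewrite big_ord_recl -(IH (fun i => A (lift ord0 i)))//.
rewrite -product_measure1E; last 2 first.
- exact: mA.
- rewrite [X in measurable X](_ : _ = \bigcap_(i in [set: 'I_n])
      ((fun x : n.-tuple R => tnth x i) @^-1` A (lift ord0 i))).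
    apply: fin_bigcap_measurable => // i _.
    rewrite -[X in measurable X]setTI; exact: measurable_tnth.
  by apply/seteqP; split => x /= h i;
    [move=> _; exact: h|exact: (h i)].
rewrite /cons_measure /pushforward.
suff E : @cons_pair R n @^-1` [set x | forall i, A i (tnth x i)] =
  A ord0 `*` [set y | forall i, A (lift ord0 i) (tnth y i)]
  by exact: (congr1 (@lebesgue_measure R \x lebesgue_tuple R n) E).
apply/seteqP; split => -[x y] /=.
  move=> h; split; first by have := h ord0; rewrite tnth0.
  by move=> i; have := h (lift ord0 i); rewrite tnthS.
by move=> [h0 h] i; case: (unliftP ord0 i) => [j|] ->;
  rewrite ?tnthS ?tnth0//; exact: h.
Qed.

Local Close Scope ereal_scope.

(* The density at [x] of the Gaussian N(mu, Sigma) on R^d, for an invertible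
   covariance matrix [Sigma]. *)
Definition gaussian_pdf (R : realType) (d : nat) (x mu : d.-tuple R)
    (Sigma : 'M[R]_d) : R :=
  let v := \row_(i < d) (tnth x i - tnth mu i) in
  (Num.sqrt ((2 * pi) ^+ d * \det Sigma))^-1 *
  expR (- ((v *m invmx Sigma *m v^T) 0 0 / 2)).

Lemma gaussian_pdf_scalar (R : realType) (d : nat) (x mu : d.-tuple R) (s : R) :
  s != 0 ->
  gaussian_pdf x mu (s ^+ 2)%:M =
  \prod_(i < d) normal_pdf (tnth mu i) s (tnth x i).
Proof.
move=> s0; under eq_bigr do rewrite normal_pdfE//.
rewrite big_split/= prodr_const card_ord /gaussian_pdf det_scalar; congr (_ * _).
  rewrite /normal_peak exprVn; congr _^-1.
  have h : 0 <= s ^+ 2 * pi *+ 2.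
    by rewrite mulrn_wge0// mulr_ge0 ?sqr_ge0 ?pi_ge0.
  rewrite -exprMn (_ : 2 * pi * s ^+ 2 = s ^+ 2 * pi *+ 2); last by ring.
  elim: {x mu} d => [|d IH]; first by rewrite !expr0 sqrtr1.
  rewrite (exprS (_ *+ 2)) sqrtrM// IH; exact: esym (exprS _ _).
rewrite -expR_sum; congr expR.
rewrite invmx_scalar mul_mx_scalar -scalemxAl !mxE mulr_sumr mulr_suml -sumrN.
apply: eq_bigr => i _; rewrite !mxE.
by field; rewrite s0.
Qed.

(* The expectation of [F Z], for [Z] with Lebesgue density [q]. *)
Definition draw (R : realType) (d : nat) (q : d.-tuple R -> R)
    (F : d.-tuple R -> \bar R) : \bar R :=
  (\int[lebesgue_tuple R d]_z ((q z)%:E * F z))%E.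

Definition reversible (R : realType) (d : nat) (p : d.-tuple R -> R)
    (K : d.-tuple R -> set (d.-tuple R) -> \bar R) : Prop :=
  forall A B : set (d.-tuple R), measurable A -> measurable B ->
  (\int[lebesgue_tuple R d]_(x in A) ((p x)%:E * K x B) =
   \int[lebesgue_tuple R d]_(x in B) ((p x)%:E * K x A))%E.

Section mad_path.
Context {R : realType} {d : nat}.
Variables (T : R) (N : nat).
Variables (f shat : R -> d.-tuple R -> d.-tuple R) (g : R -> R).
Variable p : d.-tuple R -> R.

Definition time_step : R := T / N%:R.

Definition time_grid (k : nat) : R := k%:R * time_step.

Definition backward_drift (t : R) (y : d.-tuple R) : d.-tuple R :=
  [tuple - tnth (f t y) i + g t ^+ 2 * tnth (shat t y) i | i < d].

Definition step_mean (b : d.-tuple R -> d.-tuple R) (x : d.-tuple R) :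
    d.-tuple R :=
  [tuple tnth x i + time_step * tnth (b x) i | i < d].

Definition step_cov (k : nat) : 'M[R]_d :=
  (g (time_grid k) ^+ 2 * time_step)%:M.

Definition forward_pdf (k : nat) (x x' : d.-tuple R) : R :=
  gaussian_pdf x' (step_mean (f (time_grid k)) x) (step_cov k).

Definition backward_pdf (k : nat) (y' y : d.-tuple R) : R :=
  gaussian_pdf y (step_mean (backward_drift (time_grid k)) y') (step_cov k).

(* The expectation of [F (x_k, ..., x_{k+n})] given [x_k = x], when
   x_{j+1} is drawn from [forward_pdf j x_j] for j = k, ..., k+n-1. *)
Fixpoint forward_pass (n k : nat) (x : d.-tuple R) :
    (n.+1.-tuple (d.-tuple R) -> \bar R) -> \bar R :=
  match n return (n.+1.-tuple (d.-tuple R) -> \bar R) -> \bar R with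
  | 0 => fun F => F [tuple x]
  | n'.+1 => fun F => draw (forward_pdf k x) (fun x' =>
      @forward_pass n' k.+1 x' (fun xs => F [tuple of x :: xs]))
  end.

(* The expectation of [F (y_0, ..., y_n)] given [y_n = y], when
   y_j is drawn from [backward_pdf j y_{j+1}] for j = n-1, ..., 0. *)
Fixpoint backward_pass (n : nat) (y : d.-tuple R) :
    (n.+1.-tuple (d.-tuple R) -> \bar R) -> \bar R :=
  match n return (n.+1.-tuple (d.-tuple R) -> \bar R) -> \bar R with
  | 0 => fun F => F [tuple y]
  | n'.+1 => fun F => draw (backward_pdf n' y) (fun y' =>
      @backward_pass n' y' (fun ys => F [tuple of rcons ys y]))
  end.

(* For [k : 'I_N], the states number k and k+1 of the path (z_0, ..., z_N) are
   at the positions [widen_ord (leqnSn N) k] and [lift ord0 k]. *)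
Definition forward_path_pdf (z : N.+1.-tuple (d.-tuple R)) : R :=
  \prod_(k < N)
    forward_pdf k (tnth z (widen_ord (leqnSn N) k)) (tnth z (lift ord0 k)).

Definition backward_path_pdf (z : N.+1.-tuple (d.-tuple R)) : R :=
  \prod_(k < N)
    backward_pdf k (tnth z (lift ord0 k)) (tnth z (widen_ord (leqnSn N) k)).

(* Where [p x_0 = 0], the ratio is [0] because [0^-1 = 0]. *)
Definition acceptance (x y : N.+1.-tuple (d.-tuple R)) : R :=
  Num.min 1 (p (tnth y ord0) / p (tnth x ord0) *
    ((backward_path_pdf x * forward_path_pdf y) /
     (forward_path_pdf x * backward_path_pdf y))).

(* The probability that the next state is in [B], the current state being
   [x0]. *)
Definition mad_path_kernel (x0 : d.-tuple R) (B : set (d.-tuple R)) : \bar R :=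
  forward_pass 0 x0 (fun x : N.+1.-tuple (d.-tuple R) =>
    backward_pass (tnth x ord_max) (fun y : N.+1.-tuple (d.-tuple R) =>
      (acceptance x y * \1_B (tnth y ord0) +
       (1 - acceptance x y) * \1_B x0)%:E)).

End mad_path.

(* Main.v *)
Require Import Defs.
From HB Require Import structures.
From mathcomp Require Import all_boot all_order all_algebra.
From mathcomp Require Import all_classical all_reals all_analysis.
From mathcomp Require Import measurable_realfun.
From mathcomp Require Import ring.

Set Implicit Arguments.
Unset Strict Implicit.
Unset Printing Implicit Defensive.
Import Order.TTheory GRing.Theory Num.Theory.
Import numFieldNormedType.Exports.

(* By Tonelli, the common endpoint z = x_N = y_N of the two paths can be
   integrated last, which turns int_A p(x) K(x, B) dx into a double integral
   over two paths ending at z.  There p(x_0) times the joint density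
   of the two paths, multiplied by the acceptance probability, equals
   min(q(x, y), q(y, x)) with q(x, y) = p(x_0) F(x) G(y), F and G being the
   forward and backward path densities.  This is symmetric in the two paths,
   so the accepted moves are reversible; the rejected ones stay put, so their
   contribution is symmetric in A and B. *)

Local Open Scope classical_set_scope.
Local Open Scope ring_scope.

Lemma measurable_fun_uncurry d1 d2 d3 d4 (S : measurableType d1)
    (T1 : measurableType d2) (T2 : measurableType d3) (U : measurableType d4)
    (F : T1 -> T2 -> U) (a : S -> T1) (b : S -> T2) :
  measurable_fun [set: T1 * T2] (fun t => F t.1 t.2) ->
  measurable_fun setT a -> measurable_fun setT b ->
  measurable_fun setT (fun s => F (a s) (b s)).
Proof.
move=> mF ma mb.
exact: (measurableT_comp mF (measurable_fun_pair ma mb)).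
Qed.

Lemma measurable_fun_tnth d1 d2 (S : measurableType d1) (X : measurableType d2)
    n (a : S -> n.-tuple X) i :
  measurable_fun setT a -> measurable_fun setT (fun s => tnth (a s) i).
Proof. by move=> /measurable_fun_tnthP; exact. Qed.

Lemma measurable_rcons d1 d2 (S : measurableType d1) (X : measurableType d2)
    n (a : S -> n.-tuple X) (b : S -> X) :
  measurable_fun setT a -> measurable_fun setT b ->
  measurable_fun setT (fun s => [tuple of rcons (a s) (b s)]).
Proof.
move=> ma mb; apply/measurable_fun_tnthP => i.
have [ilt|ige] := ltnP i n.
  rewrite [X in measurable_fun _ X](_ : _ = fun s => tnth (a s) (Ordinal ilt)).
    exact: measurable_fun_tnth.
  apply/funext => s /=.
  by rewrite !(tnth_nth (b s)) /= nth_rcons size_tuple ilt.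
rewrite [X in measurable_fun _ X](_ : _ = b)//.
apply/funext => s /=; rewrite (tnth_nth (b s)) /= nth_rcons size_tuple.
by rewrite ltnNge ige /= eqn_leq ige -ltnS ltn_ord.
Qed.

Lemma measurable_indic_comp {R : realType} d1 d2 (S : measurableType d1)
    (U : measurableType d2) (C : set U) (a : S -> U) :
  measurable C -> measurable_fun setT a ->
  measurable_fun setT (fun s => \1_C (a s) : R).
Proof.
by move=> mC; exact: (measurableT_comp (measurable_indic (R := R) (D := setT) mC)).
Qed.

Lemma measurable_inv_ge0 {R : realType} d (S : measurableType d) (a : S -> R) :
  (forall s, 0 <= a s) -> measurable_fun setT a ->
  measurable_fun setT (fun s => (a s)^-1).
Proof.
move=> a0 ma.
rewrite [X in measurable_fun _ X](_ : _ = fun s => a s `^ (-1)).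
  exact: (measurableT_comp (measurable_powR (-1)) ma).
by apply/funext => s; rewrite powR_inv1.
Qed.

Section path_integral.
Local Open Scope ereal_scope.
Context {d : measure_display} {X : measurableType d} {R : realType}.
Variable mu : {sigma_finite_measure set X -> \bar R}.

Fixpoint path_integral (n : nat) : (n.-tuple X -> \bar R) -> \bar R :=
  match n return (n.-tuple X -> \bar R) -> \bar R with
  | 0 => fun F => F [tuple]
  | n'.+1 => fun F => \int[mu]_x path_integral (fun w => F [tuple of x :: w])
  end.

Lemma path_integral_ge0 n (F : n.-tuple X -> \bar R) :
  (forall w, 0 <= F w) -> 0 <= path_integral F.
Proof.
by elim: n F => [|n IH] F F0 //=; apply: integral_ge0 => x _; exact: IH.
Qed.

Lemma measurable_path_integral n d' (S : measurableType d')
    (F : S -> n.-tuple X -> \bar R) :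
  measurable_fun [set: S * n.-tuple X] (fun t => F t.1 t.2) ->
  (forall s w, 0 <= F s w) ->
  measurable_fun setT (fun s => path_integral (F s)).
Proof.
elim: n d' S F => [|n IH] d' S F mF F0 /=.
  by apply: (measurable_fun_uncurry mF) => //; exact: measurable_cst.
apply: (measurable_fun_fubini_tonelli_F (m2 := mu) (fun sx : S * X =>
  path_integral (fun w => F sx.1 [tuple of sx.2 :: w]))).
  apply: IH => //.
  apply: (measurable_fun_uncurry mF); first exact: measurableT_comp.
  by apply: measurable_cons => //; exact: measurableT_comp.
by move=> x; exact: path_integral_ge0.
Qed.

Lemma integral_path_integral n d' (S : measurableType d')
    (nu : {sigma_finite_measure set S -> \bar R})
    (F : S -> n.-tuple X -> \bar R) :
  measurable_fun [set: S * n.-tuple X] (fun t => F t.1 t.2) ->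
  (forall s w, 0 <= F s w) ->
  \int[nu]_s path_integral (F s) = path_integral (fun w => \int[nu]_s F s w).
Proof.
elim: n F => [|n IH] F mF F0 //=.
rewrite (fubini_tonelli (fun sx : S * X =>
  path_integral (fun w => F sx.1 [tuple of sx.2 :: w]))) //=; last 2 first.
- apply: measurable_path_integral => //.
  apply: (measurable_fun_uncurry mF); first exact: measurableT_comp.
  by apply: measurable_cons => //; exact: measurableT_comp.
- by move=> x; exact: path_integral_ge0.
apply: eq_integral => x _; apply: IH => //.
apply: (measurable_fun_uncurry mF) => //.
by apply: measurable_cons => //; exact: measurable_cst.
Qed.

Lemma path_integralC n m (F : n.-tuple X -> m.-tuple X -> \bar R) :
  measurable_fun [set: n.-tuple X * m.-tuple X] (fun t => F t.1 t.2) ->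
  (forall v w, 0 <= F v w) ->
  path_integral (fun v => path_integral (F v)) =
  path_integral (fun w => path_integral (F ^~ w)).
Proof.
elim: n F => [|n IH] F mF F0 //=.
rewrite -integral_path_integral; last 2 first.
- apply: measurable_path_integral => //.
  apply: (measurable_fun_uncurry mF); last exact: measurableT_comp.
  by apply: measurable_cons => //; exact: measurableT_comp.
- by move=> x w; exact: path_integral_ge0.
apply: eq_integral => x _; apply: IH => //.
apply: (measurable_fun_uncurry mF) => //.
by apply: measurable_cons => //; exact: measurable_cst.
Qed.

Let measurable_cons_cst n (F : n.+1.-tuple X -> \bar R) (x : X) :
  measurable_fun setT F ->
  measurable_fun setT (fun w : n.-tuple X => F [tuple of x :: w]).
Proof.
move=> mF; apply: measurableT_comp => //.
by apply: measurable_cons => //; exact: measurable_cst.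
Qed.

Lemma path_integral_rcons n (F : n.+1.-tuple X -> \bar R) :
  measurable_fun setT F -> (forall w, 0 <= F w) ->
  path_integral F =
  \int[mu]_z path_integral (fun w => F [tuple of rcons w z]).
Proof.
elim: n F => [|n IH] F mF F0.
  by apply: eq_integral => x _ /=; congr F; exact/val_inj.
rewrite [LHS]/=.
transitivity (\int[mu]_x \int[mu]_z
    path_integral (fun w => F [tuple of x :: [tuple of rcons w z]])).
  apply: eq_integral => x _; apply: (IH (fun w => F [tuple of x :: w])) => //.
  exact: measurable_cons_cst.
rewrite (fubini_tonelli (fun xz : X * X =>
  path_integral (fun w => F [tuple of xz.1 :: [tuple of rcons w xz.2]]))) //=.
- apply: eq_integral => z _; apply: eq_integral => x _.
  by congr path_integral; apply/funext => w; congr F; exact/val_inj.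
- apply: measurable_path_integral => //; apply: measurableT_comp => //.
  apply: measurable_cons; first exact: measurableT_comp.
  by apply: measurable_rcons => //; exact: measurableT_comp.
- by move=> x; exact: path_integral_ge0.
Qed.

Lemma path_integralD n (F G : n.-tuple X -> \bar R) :
  measurable_fun setT F -> measurable_fun setT G ->
  (forall w, 0 <= F w) -> (forall w, 0 <= G w) ->
  path_integral (fun w => F w + G w) = path_integral F + path_integral G.
Proof.
elim: n F G => [|n IH] F G mF mG F0 G0 //=.
have mcons (H : n.+1.-tuple X -> \bar R) : measurable_fun setT H ->
    measurable_fun [set: X * n.-tuple X] (fun t => H [tuple of t.1 :: t.2]).
  by move=> mH; apply: measurableT_comp => //; exact: measurable_cons.
rewrite -ge0_integralD//.
- apply: eq_integral => x _; apply: IH => //.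
  + exact: measurable_cons_cst.
  + exact: measurable_cons_cst.
- by move=> x _; exact: path_integral_ge0.
- by apply: measurable_path_integral => //; exact: mcons.
- by move=> x _; exact: path_integral_ge0.
- by apply: measurable_path_integral => //; exact: mcons.
Qed.

Lemma path_integralZl n (c : R) (F : n.-tuple X -> \bar R) :
  measurable_fun setT F -> (forall w, 0 <= F w) -> (0 <= c)%R ->
  path_integral (fun w => c%:E * F w) = c%:E * path_integral F.
Proof.
move=> + + c0; elim: n F => [|n IH] F mF F0 //=.
have mcons : measurable_fun [set: X * n.-tuple X]
    (fun t => F [tuple of t.1 :: t.2]).
  by apply: measurableT_comp => //; exact: measurable_cons.
rewrite -ge0_integralZl_EFin//.
- apply: eq_integral => x _; apply: IH => //.
  exact: measurable_cons_cst.
- by move=> x _; exact: path_integral_ge0.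
- exact: measurable_path_integral.
Qed.

Definition joint_path_integral (n : nat)
    (H : n.+1.-tuple X -> n.+1.-tuple X -> \bar R) : \bar R :=
  path_integral (fun x : n.+1.-tuple X =>
    path_integral (fun v : n.-tuple X =>
      H x [tuple of rcons v (tnth x ord_max)])).

Section joint.
Variable n : nat.
Implicit Types H : n.+1.-tuple X -> n.+1.-tuple X -> \bar R.

Let measurable_inner H :
  measurable_fun setT (fun t : _ * _ => H t.1 t.2) ->
  measurable_fun [set: n.+1.-tuple X * n.-tuple X]
    (fun t => H t.1 [tuple of rcons t.2 (tnth t.1 ord_max)]).
Proof.
move=> mH; apply: (measurable_fun_uncurry mH) => //.
by apply: measurable_rcons => //; exact: measurable_fun_tnth.
Qed.

Lemma joint_path_integralC H :
  measurable_fun setT (fun t : _ * _ => H t.1 t.2) ->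
  (forall x y, 0 <= H x y) ->
  joint_path_integral H = joint_path_integral (fun x y => H y x).
Proof.
have E K : measurable_fun setT (fun t : _ * _ => K t.1 t.2) ->
    (forall x y, 0 <= K x y) ->
    joint_path_integral K = \int[mu]_z path_integral (fun w : n.-tuple X =>
      path_integral (fun v : n.-tuple X =>
        K [tuple of rcons w z] [tuple of rcons v z])).
  move=> mK K0; rewrite /joint_path_integral path_integral_rcons.
  - apply: eq_integral => z _; congr path_integral; apply/funext => w.
    congr path_integral; apply/funext => v; congr K; apply/val_inj => /=.
    congr rcons; rewrite (tnth_nth z) /= nth_rcons size_tuple ltnn eqxx//.
  - by apply: measurable_path_integral => //; exact: measurable_inner.
  - by move=> w; exact: path_integral_ge0.
move=> mH H0; rewrite !E//; last first.
  by apply: (measurable_fun_uncurry mH).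
apply: eq_integral => z _.
rewrite path_integralC//.
by apply: (measurable_fun_uncurry mH); apply: measurable_rcons => //;
  exact: measurable_cst.
Qed.

Lemma joint_path_integralD H K :
  measurable_fun setT (fun t : _ * _ => H t.1 t.2) ->
  measurable_fun setT (fun t : _ * _ => K t.1 t.2) ->
  (forall x y, 0 <= H x y) -> (forall x y, 0 <= K x y) ->
  joint_path_integral (fun x y => H x y + K x y) =
  joint_path_integral H + joint_path_integral K.
Proof.
move=> mH mK H0 K0; rewrite /joint_path_integral -path_integralD.
- congr path_integral; apply/funext => x; rewrite path_integralD//.
  + apply: (measurable_fun_uncurry mH); first exact: measurable_cst.
    by apply: measurable_rcons => //; exact: measurable_cst.
  + apply: (measurable_fun_uncurry mK); first exact: measurable_cst.
    by apply: measurable_rcons => //; exact: measurable_cst.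
- by apply: measurable_path_integral => //; exact: measurable_inner.
- by apply: measurable_path_integral => //; exact: measurable_inner.
- by move=> x; exact: path_integral_ge0.
- by move=> x; exact: path_integral_ge0.
Qed.

(* The two summands are the accepted and the rejected moves of a
   Metropolis-Hastings step with joint proposal density [q]. *)
Lemma joint_path_integral_metropolis (q : n.+1.-tuple X -> n.+1.-tuple X -> R)
    (A B : set X) : measurable A -> measurable B ->
  measurable_fun setT (fun t : _ * _ => q t.1 t.2) ->
  (forall x y, (0 <= q x y)%R) ->
  let J C D := joint_path_integral (fun x y =>
    (\1_C (tnth x ord0) * (Num.min (q x y) (q y x) * \1_D (tnth y ord0) +
     (q x y - Num.min (q x y) (q y x)) * \1_D (tnth x ord0)))%:E) in
  J A B = J B A.
Proof.
move=> mA mB mq q0 /=.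
pose m x y : R := Num.min (q x y) (q y x).
pose acc (C D : set X) (x y : n.+1.-tuple X) : \bar R :=
  (\1_C (tnth x ord0) * \1_D (tnth y ord0) * m x y)%:E.
pose rej (C D : set X) (x y : n.+1.-tuple X) : \bar R :=
  (\1_C (tnth x ord0) * \1_D (tnth x ord0) * (q x y - m x y))%:E.
have mm : measurable_fun setT (fun t : _ * _ => m t.1 t.2).
  by apply: measurable_minr => //; exact: (measurable_fun_uncurry mq).
have m0 x y : (0 <= m x y)%R by rewrite le_min !q0.
have mind C D (a b : n.+1.-tuple X * n.+1.-tuple X -> n.+1.-tuple X) :
    measurable C -> measurable D ->
    measurable_fun setT a -> measurable_fun setT b ->
    measurable_fun setT (fun s =>
      \1_C (tnth (a s) ord0) * \1_D (tnth (b s) ord0) : R)%R.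
  move=> mC mD ma mb; apply: measurable_funM;
    by apply: measurable_indic_comp => //; exact: measurable_fun_tnth.
have macc C D : measurable C -> measurable D ->
    measurable_fun setT (fun t : _ * _ => acc C D t.1 t.2).
  by move=> mC mD; apply/measurable_EFinP; apply: measurable_funM => //;
    exact: mind.
have mrej C D : measurable C -> measurable D ->
    measurable_fun setT (fun t : _ * _ => rej C D t.1 t.2).
  move=> mC mD; apply/measurable_EFinP; apply: measurable_funM.
    exact: mind.
  exact: measurable_funB.
have acc0 C D x y : 0 <= acc C D x y by rewrite lee_fin !mulr_ge0.
have rej0 C D x y : 0 <= rej C D x y.
  by rewrite lee_fin !mulr_ge0// subr_ge0 ge_min lexx.
have accC : joint_path_integral (acc A B) = joint_path_integral (acc B A).
  rewrite (joint_path_integralC (macc _ _ mA mB) (acc0 A B)).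
  congr joint_path_integral; apply/funext => x; apply/funext => y.
  by rewrite /acc /m minC [X in (X * _)%R]mulrC.
have rejC : joint_path_integral (rej A B) = joint_path_integral (rej B A).
  congr joint_path_integral; apply/funext => x; apply/funext => y.
  by rewrite /rej [X in (X * _)%R]mulrC.
have splitJ C D : measurable C -> measurable D ->
    joint_path_integral (fun x y =>
      (\1_C (tnth x ord0) * (m x y * \1_D (tnth y ord0) +
       (q x y - m x y) * \1_D (tnth x ord0)))%:E) =
    joint_path_integral (acc C D) + joint_path_integral (rej C D).
  move=> mC mD.
  rewrite -(joint_path_integralD (macc C D mC mD) (mrej C D mC mD)) //.
  congr joint_path_integral; apply/funext => x; apply/funext => y.
  by rewrite -EFinD; congr EFin; ring.
by rewrite (splitJ A B)// (splitJ B A)// accC rejC.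
Qed.

End joint.
End path_integral.

Section path_weight.
Context {R : realType} {X : Type}.
Implicit Types q : nat -> X -> X -> R.

Definition path_weight q (n : nat) (z : n.+1.-tuple X) : R :=
  \prod_(k < n) q k (tnth z (widen_ord (leqnSn n) k)) (tnth z (lift ord0 k)).

Lemma path_weight_cons q n x (w : n.+1.-tuple X) :
  path_weight q [tuple of x :: w] =
  q 0 x (tnth w ord0) * path_weight (fun k => q k.+1) w.
Proof.
rewrite /path_weight big_ord_recl; congr (q 0 _ _ * _).
  by rewrite (tnth_nth x) /= (tnth_nth x).
apply: eq_bigr => k _; rewrite tnthS; congr (q _ _ _).
by rewrite !(tnth_nth x).
Qed.

Lemma path_weight_rcons q n (w : n.+1.-tuple X) y :
  path_weight q [tuple of rcons w y] =
  path_weight q w * q n (tnth w ord_max) y.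
Proof.
rewrite /path_weight big_ord_recr; congr (_ * q n _ _).
- apply: eq_bigr => k _; congr (q _ _ _);
    rewrite !(tnth_nth y) /= nth_rcons size_tuple.
    by rewrite (ltn_trans (ltn_ord k)).
  by rewrite /bump /= add1n ltnS ltn_ord.
- by rewrite !(tnth_nth y) /= nth_rcons size_tuple ltnSn.
- by rewrite (tnth_nth y) /= nth_rcons size_tuple /bump /= add1n ltnn eqxx.
Qed.

Lemma path_weight_gt0 q n (z : n.+1.-tuple X) :
  (forall k x y, (k < n)%N -> 0 < q k x y) -> 0 < path_weight q z.
Proof. by move=> q0; apply: prodr_gt0 => k _; exact: q0. Qed.

End path_weight.

Lemma measurable_path_weight {R : realType} d1 d2 (S : measurableType d1)
    (X : measurableType d2) (q : nat -> X -> X -> R) n (a : S -> n.+1.-tuple X) :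
  (forall k, (k < n)%N ->
    measurable_fun [set: X * X] (fun t => q k t.1 t.2)) ->
  measurable_fun setT a -> measurable_fun setT (fun s => path_weight q (a s)).
Proof.
move=> mq ma; apply: measurable_prod => k _.
by apply: (measurable_fun_uncurry (mq k _)) => //; exact: measurable_fun_tnth.
Qed.

Lemma measurable_gaussian_pdf_scalar {R : realType} (d : nat) d1
    (S : measurableType d1) (u v : S -> d.-tuple R) (s : R) :
  s != 0 -> measurable_fun setT u -> measurable_fun setT v ->
  measurable_fun setT (fun t => gaussian_pdf (u t) (v t) (s ^+ 2)%:M).
Proof.
move=> s0 mu mv.
rewrite [X in measurable_fun _ X](_ : _ = fun t =>
    \prod_(i < d) (normal_peak s *
      expR (- (tnth (u t) i - tnth (v t) i) ^+ 2 / (s ^+ 2 *+ 2)))).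
  apply: measurable_prod => i _; apply: measurable_funM => //.
  apply: (measurableT_comp (@measurable_expR R)).
  apply: measurable_funM => //; apply: measurableT_comp => //.
  by apply: measurable_funX; apply: measurable_funB; exact: measurable_fun_tnth.
apply/funext => t; rewrite gaussian_pdf_scalar//.
by apply: eq_bigr => i _; rewrite normal_pdfE.
Qed.

Lemma gaussian_pdf_scalar_gt0 {R : realType} (d : nat) (x m : d.-tuple R)
    (s : R) : s != 0 -> 0 < gaussian_pdf x m (s ^+ 2)%:M.
Proof.
move=> s0; rewrite gaussian_pdf_scalar//; apply: prodr_gt0 => i _.
by rewrite normal_pdfE// mulr_gt0 ?normal_peak_gt0// expR_gt0.
Qed.

Section mad_path.
Context {R : realType} {d : nat}.
Variables (T : R) (N : nat).
Variables (f shat : R -> d.-tuple R -> d.-tuple R) (g : R -> R).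
Variable p : d.-tuple R -> R.
Hypothesis p_measurable : measurable_fun setT p.
Hypothesis p_ge0 : forall x, 0 <= p x.
Hypothesis T_gt0 : 0 < T.
Hypothesis f_measurable : measurable_fun (`[0, T] `*` [set: d.-tuple R])
  (fun tx : R * d.-tuple R => f tx.1 tx.2).
Hypothesis shat_measurable : measurable_fun (`[0, T] `*` [set: d.-tuple R])
  (fun tx : R * d.-tuple R => shat tx.1 tx.2).
Hypothesis g_neq0 : forall k, (k < N)%N -> g (time_grid T N k) != 0.

Local Notation X := (d.-tuple R).
Local Notation mu := (lebesgue_tuple R d).
Local Notation t_ := (time_grid T N).
Local Notation forward_pdf := (forward_pdf T N f g).
Local Notation backward_pdf := (backward_pdf T N f shat g).
Local Notation forward_path_pdf := (forward_path_pdf T f g).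
Local Notation backward_path_pdf := (backward_path_pdf T f shat g).
Local Notation acceptance := (acceptance T f shat g p).

Lemma time_grid_itv k : (k < N)%N -> t_ k \in `[0, T].
Proof.
move=> kN; have N0 : 0 < N%:R :> R by rewrite ltr0n (leq_ltn_trans _ kN).
rewrite in_itv /= /time_grid /time_step mulr_ge0//=; last first.
  by rewrite divr_ge0 ?ler0n// ltW.
by rewrite mulrCA ler_piMr ?ltW// ltr_pdivrMr// mul1r ltr_nat.
Qed.

Lemma measurable_time_slice (b : R -> X -> X) k : (k < N)%N ->
  measurable_fun (`[0, T] `*` [set: X]) (fun tx : R * X => b tx.1 tx.2) ->
  measurable_fun setT (b (t_ k)).
Proof.
move=> kN mb; have mI : measurable (`[0, T] `*` [set: X] : set (R * X)).
  by apply: measurableX => //; exact: measurable_itv.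
apply: (measurable_comp (g := fun x : X => (t_ k, x)) mI _ mb).
  by move=> _ [x _ <-]; split => //=; exact: time_grid_itv.
by apply: measurable_fun_pair => //; exact: measurable_cst.
Qed.

Lemma step_covE k : (k < N)%N -> exists2 s : R, s != 0 &
  step_cov (d := d) T N g k = (s ^+ 2)%:M.
Proof.
move=> kN; have h0 : 0 < time_step T N.
  by rewrite /time_step divr_gt0// ltr0n (leq_ltn_trans _ kN).
exists (g (t_ k) * Num.sqrt (time_step T N)).
  by rewrite mulf_neq0 ?g_neq0// gt_eqF// sqrtr_gt0.
by rewrite exprMn sqr_sqrtr// ltW.
Qed.

Lemma measurable_step_mean d1 (S : measurableType d1) (b : X -> X) (a : S -> X) :
  measurable_fun setT b -> measurable_fun setT a ->
  measurable_fun setT (fun s => step_mean T N b (a s)).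
Proof.
move=> mb ma; apply/measurable_fun_tnthP => i.
rewrite [X in measurable_fun _ X](_ : _ = fun s =>
    tnth (a s) i + time_step T N * tnth (b (a s)) i).
  apply: measurable_funD; first exact: measurable_fun_tnth.
  apply: measurable_funM => //; apply: measurable_fun_tnth.
  exact: measurableT_comp.
by apply/funext => s /=; rewrite tnth_mktuple.
Qed.

Lemma measurable_backward_drift k : (k < N)%N ->
  measurable_fun setT (backward_drift f shat g (t_ k)).
Proof.
move=> kN; apply/measurable_fun_tnthP => i.
rewrite [X in measurable_fun _ X](_ : _ = fun y =>
    - tnth (f (t_ k) y) i + g (t_ k) ^+ 2 * tnth (shat (t_ k) y) i).
  apply: measurable_funD.
    apply: measurableT_comp => //; apply: measurable_fun_tnth.
    exact: measurable_time_slice.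
  apply: measurable_funM => //; apply: measurable_fun_tnth.
  exact: measurable_time_slice.
by apply/funext => s /=; rewrite tnth_mktuple.
Qed.

Lemma measurable_forward_pdf k : (k < N)%N ->
  measurable_fun [set: X * X] (fun t => forward_pdf k t.1 t.2).
Proof.
move=> kN; rewrite /Defs.forward_pdf; have [s s0 ->] := step_covE kN.
apply: measurable_gaussian_pdf_scalar => //.
by apply: measurable_step_mean => //; exact: measurable_time_slice.
Qed.

Lemma measurable_backward_pdf k : (k < N)%N ->
  measurable_fun [set: X * X] (fun t => backward_pdf k t.2 t.1).
Proof.
move=> kN; rewrite /Defs.backward_pdf; have [s s0 ->] := step_covE kN.
apply: measurable_gaussian_pdf_scalar => //.
by apply: measurable_step_mean => //; exact: measurable_backward_drift.
Qed.

Lemma forward_pdf_gt0 k x y : (k < N)%N -> 0 < forward_pdf k x y.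
Proof.
move=> kN; rewrite /Defs.forward_pdf; have [s s0 ->] := step_covE kN.
exact: gaussian_pdf_scalar_gt0.
Qed.

Lemma backward_pdf_gt0 k x y : (k < N)%N -> 0 < backward_pdf k x y.
Proof.
move=> kN; rewrite /Defs.backward_pdf; have [s s0 ->] := step_covE kN.
exact: gaussian_pdf_scalar_gt0.
Qed.

Local Open Scope ereal_scope.

Lemma forward_passE n k (x : X) (F : n.+1.-tuple X -> \bar R) :
  (k + n <= N)%N -> measurable_fun setT F -> (forall z, 0 <= F z) ->
  forward_pass T N f g k x F = path_integral mu (fun w : n.-tuple X =>
    (path_weight (fun j => forward_pdf (k + j)) [tuple of x :: w])%:E *
    F [tuple of x :: w]).
Proof.
elim: n k x F => [|n IH] k x F knN mF F0 /=.
  by rewrite /path_weight big_ord0 mul1e; congr F; exact/val_inj.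
apply: eq_integral => x' _.
have kn j : (j < n)%N -> (k.+1 + j < N)%N.
  by move=> jn; rewrite (leq_trans _ knN)// addSnnS ltn_add2l.
have mcons : measurable_fun setT (fun w : n.-tuple X =>
    [tuple of x :: [tuple of x' :: w]]).
  by do 2![apply: measurable_cons; first exact: measurable_cst].
rewrite IH//; last 2 first.
- by rewrite addSnnS.
- apply: measurableT_comp => //.
  by apply: measurable_cons => //; exact: measurable_cst.
rewrite -path_integralZl; last 3 first.
- apply: emeasurable_funM.
    apply/measurable_EFinP; apply: measurable_path_weight => [j jn|].
      by apply: measurable_forward_pdf; exact: kn.
    by apply: measurable_cons => //; exact: measurable_cst.
  exact: (measurableT_comp mF mcons).
- move=> w; apply: mule_ge0 => //; rewrite lee_fin ltW//.
  by apply: path_weight_gt0 => j y z jn; apply: forward_pdf_gt0; exact: kn.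
- rewrite ltW// forward_pdf_gt0// (leq_trans _ knN)// addnS ltnS leq_addr//.
congr path_integral; apply/funext => w.
rewrite muleA -EFinM (path_weight_cons _ x [tuple of x' :: w]) addn0 tnth0.
rewrite (_ : (fun j => forward_pdf (k.+1 + j)) = fun j => forward_pdf (k + j.+1)).
  by congr (_%:E * F _); exact/val_inj.
by apply/funext => j; rewrite addSnnS.
Qed.

Lemma backward_passE n (y : X) (F : n.+1.-tuple X -> \bar R) :
  (n <= N)%N -> measurable_fun setT F -> (forall z, 0 <= F z) ->
  backward_pass T N f shat g y F = path_integral mu (fun w : n.-tuple X =>
    (path_weight (fun j a b => backward_pdf j b a) [tuple of rcons w y])%:E *
    F [tuple of rcons w y]).
Proof.
elim: n y F => [|n IH] y F nN mF F0.
  by rewrite /= /path_weight big_ord0 mul1e; congr F; exact/val_inj.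
have mrcons : measurable_fun setT (fun w : n.+1.-tuple X =>
    [tuple of rcons w y]).
  by apply: measurable_rcons => //; exact: measurable_cst.
rewrite [LHS]/= path_integral_rcons; last 2 first.
- apply: emeasurable_funM; last exact: (measurableT_comp mF mrcons).
  apply/measurable_EFinP; apply: measurable_path_weight => // j jn.
  by apply: measurable_backward_pdf; exact: leq_trans nN.
- move=> w; apply: mule_ge0 => //; rewrite lee_fin ltW//.
  apply: path_weight_gt0 => j a b jn.
  by apply: backward_pdf_gt0; exact: leq_trans nN.
apply: eq_integral => y' _; rewrite IH//; last 2 first.
- exact: ltnW.
- exact: (measurableT_comp mF mrcons).
have mrcons' : measurable_fun setT (fun w : n.-tuple X =>
    [tuple of rcons w y']).
  by apply: measurable_rcons => //; exact: measurable_cst.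
rewrite -path_integralZl; last 3 first.
- apply: emeasurable_funM.
    apply/measurable_EFinP; apply: measurable_path_weight => // j jn.
    by apply: measurable_backward_pdf; rewrite (ltn_trans jn).
  exact: (measurableT_comp mF (measurableT_comp mrcons mrcons')).
- move=> w; apply: mule_ge0 => //; rewrite lee_fin ltW//.
  apply: path_weight_gt0 => j a b jn.
  by apply: backward_pdf_gt0; rewrite (ltn_trans jn).
- by rewrite ltW// backward_pdf_gt0.
congr path_integral; apply/funext => w.
rewrite muleA -EFinM path_weight_rcons mulrC.
congr ((_ * _)%:E * _); congr (backward_pdf _ _ _).
by rewrite (tnth_nth y) /= nth_rcons size_tuple ltnn eqxx.
Qed.

Local Close Scope ereal_scope.

Lemma forward_path_pdf_gt0 (z : N.+1.-tuple X) : 0 < forward_path_pdf z.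
Proof. by apply: path_weight_gt0 => k x y; exact: forward_pdf_gt0. Qed.

Lemma backward_path_pdf_gt0 (z : N.+1.-tuple X) : 0 < backward_path_pdf z.
Proof.
apply: (@path_weight_gt0 _ _ (fun k a b => backward_pdf k b a)) => k x y.
exact: backward_pdf_gt0.
Qed.

Lemma forward_path_pdf_ge0 (z : N.+1.-tuple X) : 0 <= forward_path_pdf z.
Proof. exact/ltW/forward_path_pdf_gt0. Qed.

Lemma backward_path_pdf_ge0 (z : N.+1.-tuple X) : 0 <= backward_path_pdf z.
Proof. exact/ltW/backward_path_pdf_gt0. Qed.

Lemma measurable_forward_path_pdf d1 (S : measurableType d1)
    (a : S -> N.+1.-tuple X) : measurable_fun setT a ->
  measurable_fun setT (fun s => forward_path_pdf (a s)).
Proof.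
by move=> ma; apply: measurable_path_weight => // k;
  exact: measurable_forward_pdf.
Qed.

Lemma measurable_backward_path_pdf d1 (S : measurableType d1)
    (a : S -> N.+1.-tuple X) : measurable_fun setT a ->
  measurable_fun setT (fun s => backward_path_pdf (a s)).
Proof.
move=> ma; apply: (@measurable_path_weight _ _ _ _ _
  (fun k a b => backward_pdf k b a)) => // k.
exact: measurable_backward_pdf.
Qed.

Lemma acceptance_ge0 (x y : N.+1.-tuple X) : 0 <= acceptance x y.
Proof.
rewrite /Defs.acceptance le_min ler01 /=.
rewrite mulr_ge0 ?divr_ge0 ?p_ge0//.
- exact: (mulr_ge0 (backward_path_pdf_ge0 _) (forward_path_pdf_ge0 _)).
- exact: (mulr_ge0 (forward_path_pdf_ge0 _) (backward_path_pdf_ge0 _)).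
Qed.

Lemma acceptance_le1 (x y : N.+1.-tuple X) : acceptance x y <= 1.
Proof. by rewrite ge_min lexx. Qed.

Lemma measurable_acceptance d1 (S : measurableType d1)
    (a b : S -> N.+1.-tuple X) :
  measurable_fun setT a -> measurable_fun setT b ->
  measurable_fun setT (fun s => acceptance (a s) (b s)).
Proof.
move=> ma mb; apply: measurable_minr; first exact: measurable_cst.
have mp0 c : measurable_fun setT c ->
    measurable_fun setT (fun s : S => p (tnth (c s : N.+1.-tuple X) ord0)).
  move=> mc; apply: (measurableT_comp p_measurable).
  exact: measurable_fun_tnth.
apply: measurable_funM; apply: measurable_funM.
- exact: mp0.
- by apply: measurable_inv_ge0 => //; exact: mp0.
- apply: measurable_funM; first exact: measurable_backward_path_pdf.
  exact: measurable_forward_path_pdf.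
- apply: measurable_inv_ge0 => [s|].
    by apply: mulr_ge0; [exact: forward_path_pdf_ge0|exact: backward_path_pdf_ge0].
  apply: measurable_funM; first exact: measurable_forward_path_pdf.
  exact: measurable_backward_path_pdf.
Qed.

Definition path_flow (x y : N.+1.-tuple X) : R :=
  p (tnth x ord0) * forward_path_pdf x * backward_path_pdf y.

Lemma path_flow_ge0 x y : 0 <= path_flow x y.
Proof.
apply: mulr_ge0; last exact: backward_path_pdf_ge0.
by apply: mulr_ge0 => //; exact: forward_path_pdf_ge0.
Qed.

Lemma measurable_path_flow :
  measurable_fun setT (fun t : _ * _ => path_flow t.1 t.2).
Proof.
apply: measurable_funM; last exact: measurable_backward_path_pdf.
apply: measurable_funM; last exact: measurable_forward_path_pdf.
by apply: (measurableT_comp p_measurable); exact: measurable_fun_tnth.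
Qed.

Lemma path_flow_acceptance x y :
  path_flow x y * acceptance x y = Num.min (path_flow x y) (path_flow y x).
Proof.
have [px0|px0] := eqVneq (p (tnth x ord0)) 0.
  have q0 : path_flow x y = 0 by rewrite /path_flow px0 !mul0r.
  by rewrite q0 mul0r min_l// path_flow_ge0.
rewrite /Defs.acceptance minr_pMr ?path_flow_ge0// mulr1; congr Num.min.
have fx := lt0r_neq0 (forward_path_pdf_gt0 x).
have bY := lt0r_neq0 (backward_path_pdf_gt0 y).
by rewrite /path_flow; field; rewrite px0 fx bY.
Qed.

Lemma integral_mad_path_kernel A C : measurable A -> measurable C ->
  (\int[mu]_(x in A) ((p x)%:E * mad_path_kernel T N f shat g p x C) =
   joint_path_integral mu (fun x y : N.+1.-tuple X =>
     let m := Num.min (path_flow x y) (path_flow y x) in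
     (\1_A (tnth x ord0) * (m * \1_C (tnth y ord0) +
      (path_flow x y - m) * \1_C (tnth x ord0)))%:E))%E.
Proof.
move=> mA mC; rewrite integral_mkcond; apply: eq_integral => x0 _.
pose Psi (x y : N.+1.-tuple X) : R :=
  acceptance x y * \1_C (tnth y ord0) + (1 - acceptance x y) * \1_C x0.
have Psi0 x y : 0 <= Psi x y.
  by rewrite addr_ge0// mulr_ge0 ?acceptance_ge0// subr_ge0 acceptance_le1.
have mPsi d1 (S : measurableType d1) (a b : S -> N.+1.-tuple X) :
    measurable_fun setT a -> measurable_fun setT b ->
    measurable_fun setT (fun s => Psi (a s) (b s)).
  move=> ma mb; apply: measurable_funD; apply: measurable_funM.
  - exact: measurable_acceptance.
  - by apply: measurable_indic_comp => //; exact: measurable_fun_tnth.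
  - by apply: measurable_funB => //; exact: measurable_acceptance.
  - exact: measurable_cst.
pose bw (x : N.+1.-tuple X) := path_integral mu (fun v : N.-tuple X =>
  (backward_path_pdf [tuple of rcons v (tnth x ord_max)] *
   Psi x [tuple of rcons v (tnth x ord_max)])%:E).
have mbw_in d1 (S : measurableType d1) (a : S -> N.+1.-tuple X)
    (b : S -> N.-tuple X) :
    measurable_fun setT a -> measurable_fun setT b ->
    measurable_fun setT (fun s =>
      backward_path_pdf [tuple of rcons (b s) (tnth (a s) ord_max)] *
      Psi (a s) [tuple of rcons (b s) (tnth (a s) ord_max)]).
  move=> ma mb.
  have mr : measurable_fun setT (fun s =>
      [tuple of rcons (b s) (tnth (a s) ord_max)]).
    by apply: measurable_rcons => //; exact: measurable_fun_tnth.
  apply: measurable_funM; first exact: measurable_backward_path_pdf.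
  exact: mPsi.
have bw_in0 x (v : N.+1.-tuple X) : 0 <= backward_path_pdf v * Psi x v.
  by apply: mulr_ge0 => //; exact: backward_path_pdf_ge0.
have bwE x : backward_pass T N f shat g (tnth x ord_max)
    (fun y : N.+1.-tuple X => (Psi x y)%:E) = bw x.
  rewrite backward_passE// => [|y]; last by rewrite lee_fin.
  by apply/measurable_EFinP; apply: mPsi => //; exact: measurable_cst.
have bw_ge0 x : (0 <= bw x)%E.
  by apply: path_integral_ge0 => v; rewrite lee_fin.
have mbw : measurable_fun setT bw.
  apply: measurable_path_integral => [|x v]; last by rewrite lee_fin.
  by apply/measurable_EFinP; exact: mbw_in.
rewrite patchE.
transitivity ((\1_A x0 * p x0)%:E * mad_path_kernel T N f shat g p x0 C)%E.
  by rewrite indicE; case: (x0 \in A); rewrite ?mul1r// mul0r mul0e.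
rewrite /mad_path_kernel [X in forward_pass _ _ _ _ _ _ X](_ : _ = bw);
  last exact/funext.
have mcons : measurable_fun setT (fun w : N.-tuple X => [tuple of x0 :: w]).
  by apply: measurable_cons => //; exact: measurable_cst.
have Ap0 : 0 <= \1_A x0 * p x0 by rewrite mulr_ge0.
rewrite forward_passE// -path_integralZl//; last 2 first.
- apply: emeasurable_funM; last exact: measurableT_comp.
  by apply/measurable_EFinP; exact: measurable_forward_path_pdf.
- by move=> w; apply: mule_ge0 => //; exact: forward_path_pdf_ge0.
congr path_integral; apply/funext => w; rewrite muleA -EFinM.
rewrite -path_integralZl//; last 3 first.
- by apply/measurable_EFinP; apply: mbw_in => //; exact: measurable_cst.
- by move=> v; rewrite lee_fin.
- by apply: mulr_ge0 => //; exact: forward_path_pdf_ge0.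
congr path_integral; apply/funext => v.
rewrite -path_flow_acceptance -EFinM /path_flow tnth0; congr EFin.
rewrite /Psi.
change (path_weight _ _) with (forward_path_pdf [tuple of x0 :: w]); ring.
Qed.

End mad_path.

Theorem mainTheorem4 (R : realType) (d : nat) (p : d.-tuple R -> R)
    (T : R) (N : nat) (f shat : R -> d.-tuple R -> d.-tuple R) (g : R -> R)
    (p_measurable : measurable_fun [set: d.-tuple R] p)
    (p_ge0 : forall x, 0 <= p x)
    (p_integral : (\int[lebesgue_tuple R d]_x (p x)%:E = 1)%E)
    (T_gt0 : 0 < T) (N_ge1 : (1 <= N)%N)
    (f_measurable : measurable_fun (`[0, T] `*` [set: d.-tuple R])
      (fun tx : R * d.-tuple R => f tx.1 tx.2))
    (shat_measurable : measurable_fun (`[0, T] `*` [set: d.-tuple R])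
      (fun tx : R * d.-tuple R => shat tx.1 tx.2))
    (g_measurable : measurable_fun `[0, T] g)
    (g_neq0 : forall k, (k < N)%N -> g (time_grid T N k) != 0) :
  reversible p (mad_path_kernel T N f shat g p).
Proof.
move=> A B mA mB.
rewrite !integral_mad_path_kernel//.
apply: joint_path_integral_metropolis => //; first exact: measurable_path_flow.
exact: path_flow_ge0.
Qed.
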